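(* Let $d$ be an integer with $|d|>1$. If $f$ is a continuous self map of degree $d$ of the closed annulus $[0,1]\times S^1$, then $f$ is semiconjugate to $m_d$ on $S^1$.
   Context: $m_d:S^1\to S^1$, $m_d(z)=z^d$. The degree of $f$ is the integer $d$ such that $f_*$ is multiplication by $d$ on $H_1([0,1]\times S^1,\mathbb{Z})\cong\mathbb{Z}$. The map $f$ is semiconjugate to $m_d$ if there exists a continuous $h:[0,1]\times S^1\to S^1$ with $hf=m_dh$ such that $h_*:H_1([0,1]\times S^1,\mathbb{Z})\to H_1(S^1,\mathbb{Z})$ is an isomorphism. *)

(* Defs.v *)
From HB Require Import structures.
From mathcomp Require Import freeg.
From mathcomp Require Import all_boot all_order all_algebra.
From mathcomp Require Import ring_quotient.
From mathcomp Require Import all_classical all_reals all_analysis.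
From mathcomp Require Import complex.

Set Implicit Arguments.
Unset Strict Implicit.
Unset Printing Implicit Defensive.

Import Order.TTheory GRing.Theory Num.Theory.
Import numFieldNormedType.Exports.

Local Open Scope classical_set_scope.
Local Open Scope ring_scope.
Local Open Scope quotient_scope.

HB.instance Definition _ (A : ringType) (K : choiceType) (M : lmodType A)
    (f : K -> M) :=
  GRing.isZmodMorphism.Build {freeg K / A} M (fglift f) (lift_is_additive f).

Definition simplex (R : realType) (n : nat) : set 'rV[R]_n.+1 :=
  [set v | (forall i, 0 <= v 0 i) /\ \sum_i v 0 i = 1].
Arguments simplex : clear implicits.

(* The restriction to simplices is the face map opposite to vertex i: it is the
   linear map e_j |-> e_(lift i j). *)
Definition face_vec (R : realType) (n : nat) (i : 'I_n.+2) (v : 'rV[R]_n.+1) :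
    'rV[R]_n.+2 :=
  \row_k (if unlift i k is Some j then v 0 j else 0).

Lemma face_vec_simplex (R : realType) (n : nat) (i : 'I_n.+2)
  (v : simplex R n) : face_vec i (\val v) \in simplex R n.+1.
Proof.
have [v0 v1] := set_valP v; apply/mem_set; split=> [k|].
  by rewrite mxE; case: unliftP.
rewrite (bigD1_ord i) //= mxE unlift_none add0r -[RHS]v1.
by apply: eq_bigr => j _; rewrite mxE liftK.
Qed.

Definition face (R : realType) (n : nat) (i : 'I_n.+2) (v : simplex R n) :
    simplex R n.+1 :=
  exist _ (face_vec i (\val v)) (face_vec_simplex i v).

Lemma face_continuous (R : realType) (n : nat) (i : 'I_n.+2) :
  continuous (@face R n i).
Proof.
apply: (@continuous_comp_initial _ _ _ (set_val : simplex R n.+1 -> _)).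
move=> v; suff fi_cont : {for \val v, continuous (@face_vec R n i)}.
  by apply: (continuous_comp _ fi_cont); exact: initial_continuous.
move=> A [P /= nbhsP sPA]; rewrite nbhs_simpl/=.
exists (fun _ j => P 0 (lift i j)) => /= [k j|w Pw].
  by have := nbhsP 0 (lift i j); rewrite ord1 mxE liftK.
apply: sPA => k j; rewrite ord1 mxE; have := nbhsP 0 j; rewrite mxE.
case: unliftP => [l ->|->] nP; first exact: Pw.
exact: nbhs_singleton nP.
Qed.

HB.instance Definition _ (R : realType) (n : nat) (i : 'I_n.+2) :=
  isContinuous.Build (simplex R n) (simplex R n.+1) (@face R n i)
    (@face_continuous R n i).

Definition chain (R : realType) (n : nat) (X : topologicalType) :=
  {freeg (continuousType (simplex R n) X) / int}.

HB.instance Definition _ (R : realType) (n : nat) (X : topologicalType) :=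
  GRing.Lmodule.on (chain R n X).

Definition gen_chain (R : realType) (n : nat) (X : topologicalType)
  (s : continuousType (simplex R n) X) : chain R n X := << s >>.

(* Degree 0 uses 0.-1 = 0: the boundary map is 0 : C_0 -> C_0. *)
Definition boundary (R : realType) (n : nat) (X : topologicalType) :
    chain R n X -> chain R n.-1 X :=
  match n with
  | 0 => fun=> 0
  | m.+1 => fglift (fun s : continuousType (simplex R m.+1) X =>
      \sum_(i < m.+2) (-1) ^+ i *: gen_chain (s \o @face R m i))
  end.
Arguments boundary : simpl never.

Definition chain_map (R : realType) (n : nat) (X Y : topologicalType)
    (f : continuousType X Y) : chain R n X -> chain R n Y :=
  fglift (fun s : continuousType (simplex R n) X => gen_chain (f \o s)).

Lemma boundary_is_zmod_morphism (R : realType) (n : nat) (X : topologicalType) :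
  zmod_morphism (@boundary R n X).
Proof.
by case: n => [|n] c c'; [rewrite /boundary subrr | exact: raddfB].
Qed.

HB.instance Definition _ (R : realType) (n : nat) (X : topologicalType) :=
  GRing.isZmodMorphism.Build _ _ (@boundary R n X)
    (@boundary_is_zmod_morphism R n X).

HB.instance Definition _ (R : realType) (n : nat) (X Y : topologicalType)
    (f : continuousType X Y) :=
  GRing.isZmodMorphism.Build _ _ (@chain_map R n X Y f)
    (lift_is_additive (fun s : continuousType (simplex R n) X =>
       gen_chain (f \o s))).

Lemma chain_ext (R : realType) (n : nat) (X : topologicalType) (M : zmodType)
    (f g : {additive chain R n X -> M}) :
  (forall s, f (gen_chain s) = g (gen_chain s)) -> f =1 g.
Proof.
move=> fg c; elim/freeg_ind_dom0: c => [|k s c _ _ IH].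
  by rewrite (raddf0 f) (raddf0 g).
rewrite (raddfD f) (raddfD g) IH; congr (_ + _).
have -> : << k *g s >> = gen_chain s *~ k by rewrite /gen_chain freegU_mulz intz.
by rewrite (raddfMz f) (raddfMz g) fg.
Qed.

Lemma boundary_gen (R : realType) (n : nat) (X : topologicalType)
    (s : continuousType (simplex R n.+1) X) :
  boundary (gen_chain s) =
  \sum_(i < n.+2) (-1) ^+ i *: gen_chain (s \o @face R n i).
Proof. by rewrite /boundary liftU scale1r. Qed.

Lemma chain_map_gen (R : realType) (n : nat) (X Y : topologicalType)
    (f : continuousType X Y) (s : continuousType (simplex R n) X) :
  chain_map f (gen_chain s) = gen_chain (f \o s).
Proof. by rewrite /chain_map liftU scale1r. Qed.

Lemma boundary_chain_map (R : realType) (n : nat) (X Y : topologicalType)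
    (f : continuousType X Y) (c : chain R n X) :
  boundary (chain_map f c) = chain_map f (boundary c).
Proof.
case: n c => [|n] c; first by rewrite /boundary (raddf0 (chain_map f)).
apply: (@chain_ext R n.+1 X _ (@boundary R n.+1 Y \o chain_map f)
  (@chain_map R n X Y f \o @boundary R n.+1 X)) => s.
rewrite -[LHS]/(boundary (chain_map f (gen_chain s))).
rewrite -[RHS]/(chain_map f (boundary (gen_chain s))).
rewrite chain_map_gen (boundary_gen (f \o s)) (boundary_gen s).
rewrite (raddf_sum (chain_map f)); apply: eq_bigr => i _.
rewrite (raddfZsign (chain_map f)); congr (_ *: _).
rewrite [RHS](chain_map_gen f (s \o @face R n i)); congr gen_chain.
exact/continuousEP.
Qed.

Definition is_cycle (R : realType) (n : nat) (X : topologicalType) :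
    {pred chain R n X} :=
  [pred c | boundary c == 0].

Lemma is_cycle_zmod_closed (R : realType) (n : nat) (X : topologicalType) :
  zmod_closed (@is_cycle R n X).
Proof.
split=> [|c c']; rewrite !inE ?raddf0// => /eqP c0 /eqP c'0.
by rewrite raddfB /= c0 c'0 subrr.
Qed.

HB.instance Definition _ (R : realType) (n : nat) (X : topologicalType) :=
  GRing.isZmodClosed.Build _ (@is_cycle R n X) (@is_cycle_zmod_closed R n X).

Record cycle (R : realType) (n : nat) (X : topologicalType) :=
  Cycle { cycle_val :> chain R n X; _ : cycle_val \in @is_cycle R n X }.

HB.instance Definition _ (R : realType) (n : nat) (X : topologicalType) :=
  [isSub for @cycle_val R n X].
HB.instance Definition _ (R : realType) (n : nat) (X : topologicalType) :=
  [Choice of cycle R n X by <:].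
HB.instance Definition _ (R : realType) (n : nat) (X : topologicalType) :=
  [SubChoice_isSubZmodule of cycle R n X by <:].

(* The subgroup of cycles that are boundaries. *)
Definition bounds (R : realType) (n : nat) (X : topologicalType) :
    {pred cycle R n X} :=
  [pred z | `[< exists b : chain R n.+1 X, boundary b = \val z >]].

Lemma bounds_zmod_closed (R : realType) (n : nat) (X : topologicalType) :
  zmod_closed (@bounds R n X).
Proof.
split=> [|z z' /asboolP[b bz] /asboolP[b' bz']]; apply/asboolP.
  by exists 0; rewrite raddf0.
by exists (b - b'); rewrite raddfB /= bz bz'.
Qed.

HB.instance Definition _ (R : realType) (n : nat) (X : topologicalType) :=
  GRing.isZmodClosed.Build _ (@bounds R n X) (@bounds_zmod_closed R n X).

Definition homology (R : realType) (n : nat) (X : topologicalType) :=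
  Quotient.quot (@bounds R n X).

HB.instance Definition _ (R : realType) (n : nat) (X : topologicalType) :=
  GRing.Zmodule.on (homology R n X).
HB.instance Definition _ (R : realType) (n : nat) (X : topologicalType) :=
  EqQuotient.on (homology R n X).

Definition homology_class (R : realType) (n : nat) (X : topologicalType)
    (z : cycle R n X) : homology R n X := \pi z.

Lemma chain_map_cycle (R : realType) (n : nat) (X Y : topologicalType)
    (f : continuousType X Y) (z : cycle R n X) :
  chain_map f (\val z) \in @is_cycle R n Y.
Proof.
by rewrite inE boundary_chain_map (eqP (valP z)) (raddf0 (chain_map f)).
Qed.

Definition cycle_map (R : realType) (n : nat) (X Y : topologicalType)
    (f : continuousType X Y) (z : cycle R n X) : cycle R n Y :=
  Cycle (chain_map_cycle f z).

(* Independence of the representative is homology_map_class. *)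
Definition homology_map (R : realType) (n : nat) (X Y : topologicalType)
    (f : continuousType X Y) (x : homology R n X) : homology R n Y :=
  homology_class (cycle_map f (repr x)).

Lemma homology_class_is_zmod_morphism (R : realType) (n : nat)
    (X : topologicalType) : zmod_morphism (@homology_class R n X).
Proof.
move=> z z'; pose Q := Quotient.quot (@bounds R n X).
apply: etrans (@pi_addr _ _ _ _ _ Q z (- z')) _.
by congr (_ + _); exact: (@pi_oppr _ _ _ _ _ Q).
Qed.

HB.instance Definition _ (R : realType) (n : nat) (X : topologicalType) :=
  GRing.isZmodMorphism.Build _ _ (@homology_class R n X)
    (@homology_class_is_zmod_morphism R n X).

Lemma homology_class_eq (R : realType) (n : nat) (X : topologicalType)
    (z z' : cycle R n X) :
  homology_class z = homology_class z' <->
  exists b : chain R n.+1 X, boundary b = \val z - \val z'.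
Proof.
rewrite -raddfB; split=> [/eqmodP/asboolP //|bzz'].
exact/eqmodP/asboolP.
Qed.

Lemma homology_map_class (R : realType) (n : nat) (X Y : topologicalType)
    (f : continuousType X Y) (z : cycle R n X) :
  homology_map f (homology_class z) = homology_class (cycle_map f z).
Proof.
have /homology_class_eq[b bz] :
  homology_class (repr (homology_class z)) = homology_class z by exact: reprK.
apply/homology_class_eq; exists (chain_map f b).
by rewrite boundary_chain_map bz (raddfB (chain_map f)).
Qed.

Lemma homology_map_is_zmod_morphism (R : realType) (n : nat)
    (X Y : topologicalType) (f : continuousType X Y) :
  zmod_morphism (@homology_map R n X Y f).
Proof.
elim/quotW=> z; elim/quotW=> z'.
rewrite -[\pi z]/(homology_class z) -[\pi z']/(homology_class z') -raddfB.
rewrite !homology_map_class -raddfB; congr homology_class; apply: val_inj.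
exact: (raddfB (@chain_map R n X Y f)).
Qed.

HB.instance Definition _ (R : realType) (n : nat) (X Y : topologicalType)
    (f : continuousType X Y) :=
  GRing.isZmodMorphism.Build _ _ (@homology_map R n X Y f)
    (@homology_map_is_zmod_morphism R n X Y f).

(* R[i] carries its norm topology under the alias R[i]^o; set_type (circle R)
   then has the subspace topology. *)
Definition circle (R : realType) : set R[i]^o := [set z | `|z : R[i]| = 1].
Arguments circle : clear implicits.

Lemma circle_exprz (R : realType) (d : int) (z : circle R) :
  (\val z : R[i]) ^ d \in circle R.
Proof.
have /= z1 := set_valP z; apply/mem_set => /=.
have zX m : `|(\val z : R[i]) ^+ m| = 1 by rewrite normrX z1 expr1n.
case: d => m; first exact: zX.
by apply: etrans (normfV ((\val z : R[i]) ^+ m.+1)) _; rewrite zX invr1.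
Qed.

Definition power_map (R : realType) (d : int) (z : circle R) : circle R :=
  exist (fun w => w \in circle R) ((\val z : R[i]) ^ d) (circle_exprz d z).

Definition annulus (R : realType) : topologicalType :=
  (set_type `[0 : R, 1] * set_type (circle R))%type.

Definition has_degree (R : realType)
    (f : continuousType (annulus R) (annulus R)) (d : int) : Prop :=
  forall x : homology R 1 (annulus R), homology_map f x = x *~ d.

(* The isomorphism condition on h excludes in particular the constant maps to a
   fixed point of g. *)
Definition semiconjugate (R : realType)
    (f : continuousType (annulus R) (annulus R)) (g : circle R -> circle R) :
    Prop :=
  exists h : continuousType (annulus R) (circle R),
    h \o f =1 g \o h /\ bijective (@homology_map R 1 _ _ h).

(* Main.v *)
Require Import Defs.
From HB Require Import structures.
From mathcomp Require Import freeg.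
From mathcomp Require Import all_boot all_order all_algebra.
From mathcomp Require Import all_classical all_reals all_analysis.
From mathcomp Require Import complex.
From mathcomp Require Import ring lra zify.

(* Lifting along R -> S^1, singular 1-simplices of the circle get a winding
   number, which is additive on chains and kills boundaries.  Evaluated on the
   core loop of the annulus, the degree hypothesis says that the circle
   component of [f] is [z ^ d * exp (2 i pi v)] with [v] real, continuous and
   single-valued.  The map [h = z * exp (2 i pi u)] satisfies [h f = h ^ d] as
   soon as [d u = v + u f], which is solved by [u = \sum_k v f^k / d^(k+1)].
   Scaling [u] down to 0 is a homotopy from [h] to the projection of the annulus
   onto the circle, a homotopy equivalence, so [h] is bijective on H_1. *)

(** The group H_1 is never computed. A single homology class is tested, and the winding number turns
    the resulting equation between classes into an equation between real numbers. The obstacle is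
    that the circle component of [f] has a real-valued lift only once the annulus is cut open. The
    degree is the jump of this lift across the cut; [z ^ d] has the same jump, so the quotient of
    the two has a single-valued logarithm. Singular triangles and the annulus are both images of a
    square, so one lifting lemma for the square serves the invariance of winding numbers and the
    lift of [f]. The condition |d| > 1 makes 1/d a contraction factor, and [v] is bounded because
    the annulus is compact: the series for [u] then converges uniformly, whatever the dynamics of
    [f]. *)

Set Implicit Arguments.
Unset Strict Implicit.
Unset Printing Implicit Defensive.

Import Order.TTheory GRing.Theory Num.Theory.
Import numFieldNormedType.Exports.

Local Open Scope classical_set_scope.
Local Open Scope ring_scope.
Local Open Scope quotient_scope.

(* The library's own [Re] and [Im] are those of a numClosedFieldType. *)
Local Notation Re := (@complex.Re _).
Local Notation Im := (@complex.Im _).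

(* Instance search does not find [nbhs_filter] at the numFieldType [R[i]]. *)
#[local] Instance complex_nbhs_filter (R : realType) (z : R[i]^o) :
  ProperFilter (nbhs z) := @nbhs_pfilter R[i]^o z.

(** * The exponential covering of the unit circle *)

Lemma continuous_Re (R : realType) : continuous (fun z : R[i]^o => Re z).
Proof.
move=> z; apply/cvgrPdist_lt => e e0.
near=> w.
have zw : `|(z : R[i]) - w| < e%:C%C.
  near: w; have /(@cvgrPdist_lt _ R[i]^o) := @cvg_id _ (nbhs z).
  by apply; rewrite ltcR.
have : `|Re (z - w)|%:C%C < e%:C%C by apply: le_lt_trans zw; exact: normc_ge_Re.
by rewrite ltcR; case: (z) (w) => [? ?] [? ?].
Unshelve. all: by end_near.
Qed.

Lemma continuous_complex (R : realType) (T : topologicalType)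
    (g : T -> R[i]^o) :
  continuous (fun x => Re (g x)) -> continuous (fun x => Im (g x)) ->
  continuous g.
Proof.
move=> cRe cIm x; apply/(@cvgrPdist_lt _ R[i]^o) => -[e e'].
rewrite ltcE /= => /andP[/eqP-> e0].
have e2 : 0 < e / 2 by rewrite divr_gt0.
near=> y.
have H1 : `|Re (g x) - Re (g y)| < e / 2.
  by near: y; move: (cRe x) => /cvgrPdist_lt; exact.
have H2 : `|Im (g x) - Im (g y)| < e / 2.
  by near: y; move: (cIm x) => /cvgrPdist_lt; exact.
have -> : g x - g y =
    (Re (g x) - Re (g y))%:C%C + 'i%C * (Im (g x) - Im (g y))%:C%C.
  by case: (g x) (g y) => [a b] [a' b']; simpc.
apply: le_lt_trans (ler_normD _ _) _; rewrite normrM.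
rewrite !normc_def /= !expr0n /= ?addr0 ?add0r expr1n sqrtr1 mul1r !sqrtr_sqr.
by rewrite -(rmorphD (real_complex R)) ltcR /=; lra.
Unshelve. all: by end_near.
Qed.

Lemma continuous_Im (R : realType) : continuous (fun z : R[i]^o => Im z).
Proof.
have -> : (fun z : R[i]^o => Im z) = (fun z => Re (- ('i%C * z))).
  by apply/funext => -[a b]; simpc.
have := @continuous_Re R; move=> c z; apply: continuous_comp (c _).
by apply: cvgN; apply: cvgMr; exact: cvg_id.
Qed.

(** Angles are counted in turns, so that the kernel is the group of integers and winding numbers
    carry no factor 2 pi. *)
Definition expi (R : realType) (x : R) : R[i]^o :=
  (cos (x * (pi *+ 2)) +i* sin (x * (pi *+ 2)))%C.

Lemma expiD (R : realType) (x y : R) : expi (x + y) = (expi x : R[i]) * expi y.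
Proof. by rewrite /expi mulrDl cosD sinD; simpc; congr (_ +i* _)%C; ring. Qed.

Lemma expi0 (R : realType) : expi (0 : R) = 1.
Proof. by rewrite /expi mul0r cos0 sin0. Qed.

Lemma norm_expi (R : realType) (x : R) : `|(expi x : R[i])| = 1.
Proof. by rewrite normc_def /= cos2Dsin2 sqrtr1. Qed.

Lemma expi_neq0 (R : realType) (x : R) : (expi x : R[i]) != 0.
Proof. by rewrite -normr_eq0 norm_expi oner_eq0. Qed.

Lemma expiN (R : realType) (x : R) : expi (- x) = (expi x : R[i])^-1.
Proof.
by apply: (mulIf (expi_neq0 x)); rewrite -expiD addNr expi0 mulVf ?expi_neq0.
Qed.

Lemma expiMn (R : realType) (x : R) n : expi (x *+ n) = (expi x : R[i]) ^+ n.
Proof. by elim: n => [|n IH]; rewrite ?expi0// mulrS expiD IH exprS. Qed.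

Lemma expiMz (R : realType) (x : R) d : expi (x *~ d) = (expi x : R[i]) ^ d.
Proof. by case: d => n; rewrite ?expiMn// NegzE mulrNz expiN expiMn. Qed.

Lemma expi1 (R : realType) : expi (1 : R) = 1.
Proof. by rewrite /expi mul1r cos2pi sin2pi. Qed.

Lemma expi_int (R : realType) (k : int) : expi (k%:~R : R) = 1.
Proof. by rewrite expiMz expi1 exp1rz. Qed.

(** Only the fractional part y matters. Cosine is injective on [0, pi], which forces y = 0 when y <=
    1/2; otherwise the same argument for 1 - y gives y = 1, which is excluded. *)
Lemma expi_eq1 (R : realType) (x : R) : expi x = 1 -> x \is a Num.int.
Proof.
move=> ex1; set y := x - (Num.floor x)%:~R.
have ey1 : expi y = 1 by rewrite expiD ex1 -mulrNz expi_int mulr1.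
have [y0 y1] : 0 <= y /\ y < 1.
  rewrite subr_ge0 ltrBlDl; move: (floor_le x) (floorD1_gt x).
  by rewrite intrD1.
suff y00 : y = 0 by rewrite -(subrK (Num.floor x)%:~R x) -/y y00 add0r.
have c1 : cos (y * (pi *+ 2)) = 1 by case: ey1.
have pi0 := pi_gt0 R.
have [y2|y2] := leP y (1/2).
  have : y * (pi *+ 2) = 0.
    by apply: cos_inj; rewrite ?in_itv /= ?cos0//; apply/andP; split; nra.
  by move/eqP; rewrite mulf_eq0 => /orP[/eqP//|]; lra.
have : (1 - y) * (pi *+ 2) = 0.
  apply: cos_inj; rewrite ?in_itv /= ?cos0; try by apply/andP; split; nra.
  by rewrite mulrBl mul1r cosB c1 cos2pi sin2pi; ring.
by move/eqP; rewrite mulf_eq0 => /orP[|]; lra.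
Qed.

Lemma continuous_expi (R : realType) : continuous (@expi R).
Proof.
have cM : continuous (fun x : R => x * (pi *+ 2)).
  by move=> x; apply: cvgMl; exact: cvg_id.
apply: continuous_complex => x.
  exact: continuous_comp (cM x) (@continuous_cos R _).
exact: continuous_comp (cM x) (@continuous_sin R _).
Qed.

Lemma norm1_complex (R : realType) (z : R[i]) :
  `|z| = 1 -> Re z ^+ 2 + Im z ^+ 2 = 1.
Proof.
move=> z1; apply: (@complexI R).
by rewrite (add_Re2_Im2 z) z1 expr1n.
Qed.

(** The arccosine covers the upper half circle, and its reflection the lower half. The bounds on [x]
    are what later makes the unit square cover the annulus. *)
Lemma expi_surj (R : realType) (z : R[i]) :
  `|z| = 1 -> exists2 x : R, 0 <= x <= 1 & z = expi x.
Proof.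
move=> /norm1_complex; case: z => a b /= ab1; have pi0 := pi_gt0 R.
have a1 : -1 <= a <= 1 by apply/andP; split; nra.
have [q0 q1] : 0 <= acos a /\ acos a <= pi by rewrite acos_ge0 ?acos_lepi.
have pin0 : (pi : R) *+ 2 != 0 by lra.
have sE : sin (acos a) = `|b|.
  by rewrite sin_acos// -sqrtr_sqr; congr Num.sqrt; lra.
have [b0|b0] := leP 0 b.
  exists (acos a / (pi *+ 2)).
    by rewrite divr_ge0 ?ler_pdivrMr/=; nra.
  by rewrite /expi divfK// acosK ?in_itv// sE ger0_norm.
exists (1 - acos a / (pi *+ 2)).
  rewrite subr_ge0 lerBlDr lerDl divr_ge0 ?ler_pdivrMr/=; nra.
rewrite /expi mulrBl mul1r divfK// cosB sinB cos2pi sin2pi acosK ?in_itv//.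
by rewrite sE ltr0_norm//; congr (_ +i* _)%C; ring.
Qed.

(* The principal argument, in turns, on the right half of the unit circle. *)
Definition small_arg (R : realType) (z : R[i]^o) : R := asin (Im z) / (pi *+ 2).

Lemma expi_small_arg (R : realType) (z : R[i]) :
  `|z| = 1 -> 0 <= Re z -> expi (small_arg z) = z.
Proof.
move=> /norm1_complex; case: z => a b /= ab1 a0; have pi0 := pi_gt0 R.
have b1 : -1 <= b <= 1 by apply/andP; split; nra.
have pin0 : (pi : R) *+ 2 != 0 by lra.
rewrite /expi /small_arg /= divfK// asinK ?in_itv// cos_asin//.
have -> : 1 - b ^+ 2 = a ^+ 2 by lra.
by rewrite sqrtr_sqr ger0_norm.
Qed.

Lemma continuous_small_arg (R : realType) (z : R[i]^o) :
  `|(z : R[i])| = 1 -> 0 < Re z -> {for z, continuous (@small_arg R)}.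
Proof.
move=> /norm1_complex ab1 a0; apply: cvgMl.
apply: continuous_comp; first exact: continuous_Im.
by apply: continuous_asin; apply/andP; split; nra.
Qed.

(** * Lifting maps from the square to the circle *)

Lemma continuous_pair (T U V : topologicalType) (f : T -> U) (g : T -> V) :
  continuous f -> continuous g -> continuous (fun x => (f x, g x)).
Proof. by move=> cf cg x; apply: (cvg_pair (cf x) (cg x)). Qed.

Lemma continuous_fst (U V : topologicalType) : continuous (@fst U V).
Proof. by move=> -[a b]; exact: cvg_fst. Qed.

Lemma continuous_snd (U V : topologicalType) : continuous (@snd U V).
Proof. by move=> -[a b]; exact: cvg_snd. Qed.

Lemma continuous_comp_total (T U V : topologicalType) (f : T -> U)
    (g : U -> V) :
  continuous f -> continuous g -> continuous (fun x => g (f x)).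
Proof. by move=> cf cg x; apply: (continuous_comp (cf x) (cg (f x))). Qed.

Lemma continuous_section1 (T U V : topologicalType) (G : T * U -> V) (y : U) :
  continuous G -> continuous (fun x => G (x, y)).
Proof.
apply: continuous_comp_total.
by apply: continuous_pair => x; [exact: cvg_id | exact: cst_continuous].
Qed.

Lemma continuous_section2 (T U V : topologicalType) (G : T * U -> V) (x : T) :
  continuous G -> continuous (fun y => G (x, y)).
Proof.
apply: continuous_comp_total.
by apply: continuous_pair => y; [exact: cst_continuous | exact: cvg_id].
Qed.

(** Heine-Cantor with only one of the two points in [K], from compactness as a near-covering
    property along the radii tending to 0 from the right. *)
Lemma compact_unif_continuous (R : realType) (T V : pseudoMetricType R)
    (K : set T) (g : T -> V) (e : R) :
  compact K -> (forall x, K x -> {for x, continuous g}) -> 0 < e ->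
  exists2 d : R, 0 < d & forall x y, K x -> ball x d y -> ball (g x) e (g y).
Proof.
move=> /compact_near_coveringP cK cg e0.
have e20 : 0 < e / 2 by rewrite divr_gt0.
have [] := cK R (0^'+)
  (fun d x => 0 < d -> forall y, ball x d y -> ball (g x) e (g y)) _.
  move=> x Kx.
  have /nbhs_ballP[r /= r0 rg] := cg x Kx _ (nbhsx_ballx (g x) _ e20).
  have r20 : 0 < r / 2 by rewrite divr_gt0.
  exists (ball x (r / 2), [set d | d < r / 2]).
    split; first exact: nbhsx_ballx.
    exact: nbhs_right_lt.
  move=> [x' d] /= [xx' dr] d0 y x'y.
  have gx' : ball (g x) (e / 2) (g x').
    by apply: rg; apply: le_ball xx'; lra.
  have gy : ball (g x) (e / 2) (g y).
    apply: rg; rewrite (splitr r); apply: ball_triangle xx' _.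
    by apply: le_ball x'y; exact: ltW.
  by rewrite (splitr e); apply: ball_triangle gy; exact: ball_sym.
move=> r /= r0 rP; exists (r / 2); first by rewrite divr_gt0.
move=> x y Kx; apply: (rP (r / 2)) => //=; last by rewrite divr_gt0.
  by rewrite sub0r normrN gtr0_norm ?divr_gt0//; lra.
by rewrite divr_gt0.
Qed.

(** Retracting the line onto [0, 1] makes paths and homotopies total on R, so that their continuity
    is not relative to a subspace. *)
Definition clamp (R : realType) (x : R) : R := Num.max 0 (Num.min x 1).

Lemma continuous_clamp (R : realType) : continuous (@clamp R).
Proof.
move=> x; apply: (@continuous_max _ _ (fun=> 0) (fun x : R => Num.min x 1)).
  exact: cvg_cst.
by apply: (@continuous_min _ _ id (fun=> 1)); [exact: cvg_id|exact: cvg_cst].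
Qed.

Lemma clamp_itv (R : realType) (x : R) : 0 <= clamp x <= 1.
Proof.
rewrite /clamp le_max lexx /= ge_max ler01 /= ge_min lexx orbT //.
Qed.

Lemma clamp_id (R : realType) (x : R) : 0 <= x <= 1 -> clamp x = x.
Proof. by move=> /andP[x0 x1]; rewrite /clamp min_l// max_r. Qed.

(** For unit vectors, Re (w / z) is the scalar product, that is 1 - |z - w|^2 / 2, and here |z -
    w|^2 < 1/2. *)
Lemma Re_div_gt0 (R : realType) (z w : R[i]) : `|z| = 1 -> `|w| = 1 ->
  `|Re z - Re w| < 1 / 2 -> `|Im z - Im w| < 1 / 2 -> 0 < Re (w / z).
Proof.
move=> /norm1_complex z1 /norm1_complex w1.
case: z w z1 w1 => a b [a' b'] /= z1 w1.
rewrite !ltr_norml => /andP[? ?] /andP[? ?].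
rewrite /GRing.inv /=; simpc => /=; rewrite z1 !divr1; nra.
Qed.

(* On the segment from the origin to x, cut into N equal steps, the value of g
   moves by less than a quarter turn at each step: add up the small angles. *)
Lemma circle_lift_square (R : realType) (g : R * R -> R[i]^o) :
  continuous g -> (forall x, `|(g x : R[i])| = 1) ->
  exists2 G : R * R -> R, continuous G &
    forall x, 0 <= x.1 <= 1 -> 0 <= x.2 <= 1 -> g x = expi (G x).
Proof.
move=> cg g1.
(* Balls of [R * R] are boxes, so uniform continuity of [g'] bounds both coordinate differences, as
   [Re_div_gt0] asks. *)
pose g' x := (Re (g x), Im (g x)).
have cg' : continuous g'.
  apply: continuous_pair; apply: (continuous_comp_total cg).
    exact: continuous_Re.
  exact: continuous_Im.
pose K : set (R * R) := `[0, 1] `*` `[0, 1].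
have cK : compact K by apply: compact_setX; exact: segment_compact.
have half_gt0 : 0 < 1 / 2 :> R by lra.
have [d d0 dP] := compact_unif_continuous cK (fun x _ => cg' x) half_gt0.
(* Consecutive points of the subdivision differ by at most 1/N in each coordinate, and this choice
   gives 1/N < d. *)
pose N := (Num.truncn d^-1).+1.
have N0 : 0 < N%:R :> R by rewrite ltr0n.
have Nd : N%:R^-1 < d.
  by rewrite invf_plt ?posrE// truncnS_gt.
pose p (j : nat) (x : R * R) : R * R :=
  (j%:R / N%:R * clamp x.1, j%:R / N%:R * clamp x.2).
have cp j : continuous (p j).
  have [c1 c2] := (@continuous_fst R R, @continuous_snd R R).
  apply: continuous_pair => x; apply: cvgMr.
    exact: (continuous_comp_total c1 (@continuous_clamp R)).
  exact: (continuous_comp_total c2 (@continuous_clamp R)).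
have pK j x : (j <= N)%N -> K (p j x).
  move=> jN; have j1 : 0 <= (j%:R / N%:R : R) <= 1.
    by rewrite divr_ge0 ?ler0n//= ler_pdivrMr// mul1r ler_nat.
  have /andP[? ?] := clamp_itv x.1; have /andP[? ?] := clamp_itv x.2.
  case/andP: j1 => ? ?.
  by split; rewrite /= in_itv /=; apply/andP; split; nra.
have pB j x : ball (p j x) d (p j.+1 x).
  have H y : `|j%:R / N%:R * clamp y - j.+1%:R / N%:R * clamp y| < d.
    have -> : j%:R / N%:R * clamp y - j.+1%:R / N%:R * clamp y =
        - (N%:R^-1 * clamp y).
      by rewrite -[in j.+1]addn1 natrD; ring.
    rewrite normrN.
    have /andP[? ?] := clamp_itv y.
    have N1 : 0 < (N%:R : R)^-1 by rewrite invr_gt0.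
    rewrite ger0_norm; last by rewrite mulr_ge0// ltW.
    by apply: le_lt_trans Nd; rewrite ler_piMr// ltW.
  by split; exact: H.
pose q j x := (g (p j.+1 x) : R[i]) / g (p j x).
have q1 j x : `|q j x| = 1 by rewrite normrM normfV !g1 invr1 mulr1.
have q0 j x : (j < N)%N -> 0 < Re (q j x).
  move=> jN; have [/= h1 h2] := dP _ _ (pK j x (ltnW jN)) (pB j x).
  exact: Re_div_gt0.
have cq j : continuous (q j : _ -> R[i]^o).
  move=> x; apply: (@cvgM R[i]^o).
    exact: continuous_comp (cp _ _) (cg _).
  apply: cvgV; first by rewrite -normr_eq0 g1 oner_eq0.
  exact: continuous_comp (cp _ _) (cg _).
(* All segments start at the origin, so a single constant [t0] initialises the lift for every
   [x]. *)
have [t0 _ gt0] := expi_surj (g1 (0, 0)).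
pose S k x := t0 + \sum_(j < k) small_arg (q j x).
have SE k x : (k <= N)%N -> expi (S k x) = g (p k x).
  elim: k => [_|k IH kN].
    by rewrite /S big_ord0 addr0 -gt0 /p !mul0r.
  rewrite /S big_ord_recr /= addrA expiD IH ?(ltnW kN)//.
  rewrite expi_small_arg ?q1 ?ltW ?q0//.
  by rewrite /q mulrC divfK// -normr_eq0 g1 oner_eq0.
have cS k : (k <= N)%N -> continuous (S k).
  elim: k => [_|k IH kN] x.
    by rewrite /S; under eq_fun do rewrite big_ord0; exact: cvg_cst.
  rewrite /S; under eq_fun do rewrite big_ord_recr /= addrA.
  apply: cvgD; first exact: IH (ltnW kN) x.
  apply: continuous_comp (cq _ _) _.
  by apply: continuous_small_arg; rewrite ?q0.
exists (S N) => [|x x1 x2]; first exact: cS.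
rewrite SE//; congr g; rewrite /p !clamp_id// divff ?gt_eqF// !mul1r.
by case: (x).
Qed.

(** * Winding numbers of singular 1-chains *)

Lemma continuous_rV (T U : topologicalType) n (g : T -> 'rV[U]_n) :
  (forall j, continuous (fun x => g x 0 j)) -> continuous g.
Proof.
move=> cg x A [P /= nP PA].
suff : \forall y \near x, forall ij : 'I_1 * 'I_n, P ij.1 ij.2 (g y ij.1 ij.2).
  apply: filterS => y Py; apply: PA => i j; exact: (Py (i, j)).
apply: filter_forall => -[i j] /=; rewrite ord1; apply: cg.
by have := nP 0 j.
Qed.

Definition bary (R : realType) n (j : 'I_n.+1) (v : simplex R n) : R :=
  (\val v : 'rV[R]_n.+1) 0 j.

Lemma continuous_bary (R : realType) n (j : 'I_n.+1) :
  continuous (@bary R n j).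
Proof.
have cv : continuous (set_val : simplex R n -> 'rV[R]_n.+1).
  exact: initial_continuous.
exact: (continuous_comp_total cv (@coord_continuous _ _ _ 0 j)).
Qed.

Lemma continuous_simplex (R : realType) (T : topologicalType) n
    (g : T -> simplex R n) :
  (forall j, continuous (fun x => bary j (g x))) ->
  continuous g.
Proof.
move=> cg; apply: (@continuous_comp_initial _ _ _ (set_val : simplex R n -> _)).
exact: continuous_rV.
Qed.

Lemma continuous_circle (R : realType) (T : topologicalType)
    (g : T -> circle R) :
  continuous (fun x => \val (g x) : R[i]^o) -> continuous g.
Proof.
exact: (@continuous_comp_initial (set_type (circle R)) T R[i]^o set_val g).
Qed.

Lemma continuous_circle_val (R : realType) :
  continuous (fun z : circle R => \val z : R[i]^o).
Proof. exact: initial_continuous. Qed.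

Lemma norm_circle (R : realType) (z : circle R) : `|(\val z : R[i])| = 1.
Proof. exact: (set_valP z). Qed.

Lemma expi_in_circle (R : realType) (x : R) : expi x \in circle R.
Proof. by apply/mem_set; exact: norm_expi. Qed.

Definition circle_expi (R : realType) (x : R) : circle R :=
  exist _ (expi x) (expi_in_circle x).

Lemma continuous_circle_expi (R : realType) : continuous (@circle_expi R).
Proof. by apply: continuous_circle; exact: continuous_expi. Qed.

(** Otherwise the intermediate value theorem would produce the half-integer value [k + 1/2]. *)
Lemma continuous_int_not_lt (R : realType) (f : R -> R) : continuous f ->
  (forall x, 0 <= x <= 1 -> f x \is a Num.int) -> ~ f 0 < f 1.
Proof.
move=> cf fint.
have /intrP[k fk] : f 0 \is a Num.int by apply: fint; rewrite lexx ler01.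
have /intrP[l fl] : f 1 \is a Num.int by apply: fint; rewrite lexx ler01.
rewrite fk fl ltr_int => kl.
have kl' : k%:~R + 1 <= l%:~R :> R by rewrite -intrD1 ler_int; lia.
have [||c] := @IVT R f 0 1 (k%:~R + 1 / 2) ler01.
- exact: continuous_subspaceT.
- rewrite fk fl ge_min le_max.
  by apply/andP; split; apply/orP; [left | right]; lra.
rewrite in_itv /= => /fint/intrP[m ->] mk.
have : (m * 2)%:~R = (2 * k + 1)%:~R :> R by rewrite intrD !intrM mk; field.
by move/intr_inj; lia.
Qed.

Lemma continuous_int_endpoints (R : realType) (f : R -> R) : continuous f ->
  (forall x, 0 <= x <= 1 -> f x \is a Num.int) -> f 0 = f 1.
Proof.
move=> cf fint; apply/eqP; rewrite eq_le !leNgt; apply/andP; split; apply/negP.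
  have cN : continuous (fun x => - f x) by move=> x; apply: cvgN; exact: cf.
  move=> lt; apply: (continuous_int_not_lt cN); last by rewrite ltrN2.
  by move=> x /fint; rewrite rpredN.
exact: continuous_int_not_lt.
Qed.

(** Two lifts of one path differ by a continuous integer-valued function. This makes [winding]
    independent of the chosen lift, and also compares increments along different sides of a
    square. *)
Lemma lift_endpoints (R : realType) (F G : R -> R) :
  continuous F -> continuous G ->
  (forall x, 0 <= x <= 1 -> expi (F x) = expi (G x)) ->
  F 1 - F 0 = G 1 - G 0.
Proof.
move=> cF cG FG.
have : F 0 - G 0 = F 1 - G 1.
  apply: (@continuous_int_endpoints R (fun x => F x - G x)).
    by move=> x; apply: cvgB; [exact: cF|exact: cG].
  move=> x /FG e; apply: expi_eq1.
  by rewrite expiD expiN e divff// expi_neq0.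
by move=> H; lra.
Qed.

Definition edge_vec (R : realType) (t : R) : 'rV[R]_2 :=
  \row_j (if j == 0 then 1 - clamp t else clamp t).

Lemma edge_vec_simplex (R : realType) (t : R) : edge_vec t \in simplex R 1.
Proof.
have /andP[t0 t1] := clamp_itv t.
apply/mem_set; split=> [j|]; last first.
  by rewrite !big_ord_recl big_ord0 !mxE /=; lra.
by rewrite mxE; case: ifP => _; lra.
Qed.

Definition edge (R : realType) (t : R) : simplex R 1 :=
  exist _ (edge_vec t) (edge_vec_simplex t).

Lemma continuous_edge (R : realType) : continuous (@edge R).
Proof.
have cc := @continuous_clamp R.
apply: continuous_simplex => j; under eq_fun do rewrite /bary mxE.
case: (j == 0) => // x; apply: cvgB; [exact: cvg_cst|exact: cc].
Qed.

(* The square covers the triangle, collapsing the side [x.1 = 0] to vertex 0. *)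
Definition triangle_vec (R : realType) (x : R * R) : 'rV[R]_3 :=
  \row_j (if j == 0 then 1 - clamp x.1
          else if j == 1 then clamp x.1 * (1 - clamp x.2)
          else clamp x.1 * clamp x.2).

Lemma triangle_vec_simplex (R : realType) (x : R * R) :
  triangle_vec x \in simplex R 2.
Proof.
have /andP[? ?] := clamp_itv x.1; have /andP[? ?] := clamp_itv x.2.
apply/mem_set; split=> [j|]; last first.
  by rewrite !big_ord_recl big_ord0 !mxE /=; lra.
by rewrite mxE; case: ifP => _; last case: ifP => _; nra.
Qed.

Definition triangle (R : realType) (x : R * R) : simplex R 2 :=
  exist _ (triangle_vec x) (triangle_vec_simplex x).

Lemma continuous_triangle (R : realType) : continuous (@triangle R).
Proof.
have c1 := continuous_comp_total (@continuous_fst R R) (@continuous_clamp R).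
have c2 := continuous_comp_total (@continuous_snd R R) (@continuous_clamp R).
apply: continuous_simplex => j; under eq_fun do rewrite /bary mxE.
case: (j == 0) => [x|]; first by apply: cvgB; [exact: cvg_cst|exact: c1].
case: (j == 1) => x; apply: cvgM; do ?[exact: c1|exact: c2].
by apply: cvgB; [exact: cvg_cst|exact: c2].
Qed.

Definition path_lift (R : realType) (s : simplex R 1 -> circle R)
    (G : R -> R) :=
  continuous G /\ forall t, 0 <= t <= 1 -> \val (s (edge t)) = expi (G t).

(* When s has no lift, which never occurs for a continuous s, this is 0. *)
Definition winding (R : realType) (s : simplex R 1 -> circle R) : R :=
  let G := xget (fun=> 0) [set G | path_lift s G] in G 1 - G 0.

Lemma path_lift_winding (R : realType) (s : simplex R 1 -> circle R) G :
  path_lift s G -> winding s = G 1 - G 0.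
Proof.
move=> sG; rewrite /winding; case: xgetP => [F _ [cF FE]|/(_ G)//].
case: sG => cG GE; apply: lift_endpoints => // x x01.
by rewrite -FE// -GE.
Qed.

(** Thanks to this, one lift over the square restricts to lifts of all three faces of a singular
    triangle. *)
Lemma face_edge (R : realType) (x y t : R) (k : 'I_3) :
  0 <= t <= 1 ->
  [\/ [/\ k = 0, x = 1 & y = t], [/\ k = 1, x = t & y = 1] |
      [/\ k = 2, x = t & y = 0]] ->
  face k (edge t) = triangle (x, y).
Proof.
move=> t01 H; apply/val_inj/rowP => j.
have c0 : clamp 0 = 0 :> R by rewrite clamp_id ?lexx ?ler01.
have c1 : clamp 1 = 1 :> R by rewrite clamp_id ?lexx ?ler01.
have ct := clamp_id t01.
case: H => -[-> -> ->]; rewrite /= !mxE /= ?c0 ?c1 ct.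
all: case: j => -[|[|[|//]]] ij.
all: case: unliftP => [l /(congr1 val)/= | /(congr1 val)//=]; rewrite /bump /=.
all: try (case: l => -[|[|//]] il //= _; rewrite ?mxE /= ?ct; ring).
all: by move=> _; ring.
Qed.

(** The alias [zmodule R] views R as a module over the integers, the kind of target that [fglift]
    expects for integral chains. *)
Definition winding_chain (R : realType) : chain R 1 (circle R) -> zmodule R :=
  fglift (fun s : continuousType (simplex R 1) (circle R) =>
    winding s : zmodule R).

HB.instance Definition _ (R : realType) :=
  GRing.isZmodMorphism.Build _ _ (@winding_chain R)
    (lift_is_additive (fun s : continuousType (simplex R 1) (circle R) =>
       winding s : zmodule R)).

Lemma winding_chain_gen (R : realType)
    (s : continuousType (simplex R 1) (circle R)) :
  winding_chain (gen_chain s) = winding s.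
Proof. by rewrite /winding_chain liftU scale1r. Qed.

(** With a lift G over the square, the alternating sum of the increments over the three faces
    telescopes to G (0, 1) - G (0, 0), the increment along the collapsed side. *)
Lemma winding_boundary_gen (R : realType)
    (s : continuousType (simplex R 2) (circle R)) :
  winding_chain (boundary (gen_chain s)) = 0.
Proof.
rewrite boundary_gen !big_ord_recl big_ord0 /= addr0.
rewrite expr0 expr1 sqrrN expr1n !scale1r scaleN1r raddfD raddfD raddfN /=.
rewrite !winding_chain_gen.
have cf : continuous (fun x : R * R => \val (s (triangle x)) : R[i]^o).
  apply: (continuous_comp_total _ (@continuous_circle_val R)).
  exact: (continuous_comp_total (@continuous_triangle R) (@cts_fun _ _ s)).
have [G cG GE] := circle_lift_square cf (fun x => norm_circle _).
have cl y := continuous_section1 (y := y) cG.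
have cr x := continuous_section2 (x := x) cG.
have i0 : 0 <= (0 : R) <= 1 by rewrite lexx ler01.
have i1 : 0 <= (1 : R) <= 1 by rewrite lexx ler01.
rewrite (@path_lift_winding _ _ (fun t => G (1, t))); last first.
  split=> // t t01; rewrite -GE//=; congr (\val (s _)).
  by apply: face_edge => //; constructor 1; split=> //; exact: val_inj.
rewrite (@path_lift_winding _ _ (fun t => G (t, 1))); last first.
  split=> // t t01; rewrite -GE//=; congr (\val (s _)).
  by apply: face_edge => //; constructor 2; split=> //; exact: val_inj.
rewrite (@path_lift_winding _ _ (fun t => G (t, 0))); last first.
  split=> // t t01; rewrite -GE//=; congr (\val (s _)).
  by apply: face_edge => //; constructor 3; split=> //; exact: val_inj.
(* On this side the map is constant, so its lift has the same increment as a constant lift. *)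
have : G (0, 1) - G (0, 0) = G (0, 0) - G (0, 0).
  apply: (@lift_endpoints R (fun t => G (0, t)) (fun t => G (0, 0))) => //.
    by move=> ?; exact: cvg_cst.
  move=> t t01; rewrite -!GE//; congr (\val (s _)); apply/val_inj/rowP => j.
  by rewrite !mxE /= !clamp_id// !mul0r.
by move=> H; rewrite -[RHS](subrr (G (0,0) : R)) -H; lra.
Qed.

Lemma winding_boundary (R : realType) (c : chain R 2 (circle R)) :
  winding_chain (boundary c) = 0.
Proof.
apply: (@chain_ext R 2 _ _ (@winding_chain R \o @boundary R 2 _)
  (\0 : {additive _ -> zmodule R})) => s.
exact: winding_boundary_gen.
Qed.

(** * The degree of an annulus map and its lift *)

Definition cts_of (T U : topologicalType) (f : T -> U) (cf : continuous f) :
    continuousType T U :=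
  HB.pack f (isContinuous.Build T U f cf).

Lemma clamp_mem (R : realType) (t : R) : clamp t \in (`[0, 1]%classic : set R).
Proof. by apply/mem_set; rewrite /= in_itv /= clamp_itv. Qed.

Definition interval_pt (R : realType) (t : R) : set_type `[0 : R, 1] :=
  exist _ (clamp t) (clamp_mem t).

Lemma continuous_interval_pt (R : realType) : continuous (@interval_pt R).
Proof.
apply: (@continuous_comp_initial (set_type `[0 : R, 1]) R R set_val).
exact: continuous_clamp.
Qed.

Lemma continuous_interval_val (R : realType) :
  continuous (fun t : set_type `[0 : R, 1] => \val t : R).
Proof. exact: initial_continuous. Qed.

Lemma continuous_annulus_fst (R : realType) :
  continuous (fun x : annulus R => \val x.1 : R).
Proof.
apply: (@continuous_comp_total (annulus R) (set_type `[0 : R, 1]) R fst val).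
  exact: continuous_fst.
exact: continuous_interval_val.
Qed.

Lemma continuous_annulus_snd (R : realType) :
  continuous (fun x : annulus R => x.2).
Proof. exact: (@continuous_snd (set_type `[0 : R, 1]) (circle R)). Qed.

Definition annulus_pt (R : realType) (x : R * R) : annulus R :=
  (interval_pt x.1, circle_expi x.2).

Lemma continuous_annulus_pt (R : realType) : continuous (@annulus_pt R).
Proof.
apply: (@continuous_pair _ _ _ (fun x : R * R => interval_pt x.1)
  (fun x => circle_expi x.2)).
  apply: continuous_comp_total (@continuous_interval_pt R).
  exact: continuous_fst.
apply: continuous_comp_total (@continuous_circle_expi R).
exact: continuous_snd.
Qed.

Definition annulus_proj (R : realType) :
    continuousType (annulus R) (circle R) :=
  cts_of (@continuous_annulus_snd R).

Definition core_loop_fun (R : realType) (v : simplex R 1) : annulus R :=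
  annulus_pt (0, bary 1 v).

Lemma continuous_core_loop (R : realType) : continuous (@core_loop_fun R).
Proof.
apply: (continuous_comp_total _ (@continuous_annulus_pt R)).
apply: continuous_pair; last exact: continuous_bary.
exact: cst_continuous.
Qed.

Definition core_loop (R : realType) :
    continuousType (simplex R 1) (annulus R) :=
  cts_of (@continuous_core_loop R).

Lemma core_loop_cycle (R : realType) :
  gen_chain (core_loop R) \in @is_cycle R 1 (annulus R).
Proof.
rewrite inE boundary_gen !big_ord_recl big_ord0 addr0 expr0 expr1.
rewrite scale1r scaleN1r.
rewrite subr_eq0; apply/eqP; congr gen_chain; apply/continuousEP => v /=.
rewrite /core_loop_fun /annulus_pt /bary /=; congr pair; apply/val_inj => /=.
rewrite !mxE.
have [_ v1] := set_valP v; move: v1; rewrite big_ord1 => v1.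
case: unliftP => [j|/(congr1 val)//]; rewrite (ord1 j) => _.
case: unliftP => [k /(congr1 val)|]; first by rewrite (ord1 k).
by rewrite v1 expi1 expi0.
Qed.

(** By hypothesis the image of the core loop differs from [d] times the loop by a boundary.
    Projected to the circle this boundary has winding 0, while the core loop itself lifts to the
    identity and has winding 1. *)
Lemma has_degree_winding (R : realType) (d : int)
    (f : continuousType (annulus R) (annulus R)) : has_degree f d ->
  winding (fun v => (f (core_loop R v)).2) = d%:~R.
Proof.
move=> /(_ (homology_class (Cycle (core_loop_cycle R)))).
rewrite homology_map_class -raddfMz => /homology_class_eq[b] bE.
have := winding_boundary (chain_map (annulus_proj R) b).
rewrite boundary_chain_map bE /=.
have -> : cycle_val (Cycle (core_loop_cycle R) *~ d) =
    gen_chain (core_loop R) *~ d.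
  exact: (raddfMz val).
rewrite raddfB raddfMz /= !chain_map_gen raddfB raddfMz /= !winding_chain_gen.
rewrite (@path_lift_winding _ (annulus_proj R \o core_loop R) id).
  by rewrite subr0 => /eqP; rewrite subr_eq0 => /eqP.
split; first by move=> x; exact: cvg_id.
by move=> t t01; rewrite /= /bary mxE /= clamp_id.
Qed.

(** * Descent of functions from the square to the annulus *)

Lemma injective_hausdorff (T U : topologicalType) (f : T -> U) :
  continuous f -> injective f -> hausdorff_space U -> hausdorff_space T.
Proof.
move=> cf fI hU p q pq; apply/fI/hU => A B /cf pA /cf qB.
by have [x [xA xB]] := pq _ _ pA qB; exists (f x).
Qed.

(** The preimage of a closed set under [v] is the image under [q] of a compact set, hence closed in
    the Hausdorff space [X]. *)
Lemma continuous_compact_factor (T X Y : topologicalType) (K : set T)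
    (q : T -> X) (v : X -> Y) (V : T -> Y) :
  hausdorff_space X -> compact K -> continuous q -> continuous V ->
  (forall x, exists2 t, K t & q t = x) -> (forall t, K t -> v (q t) = V t) ->
  continuous v.
Proof.
move=> hX cK cq cV qK vV; apply/continuous_closedP => A cA.
have -> : v @^-1` A = q @` (K `&` V @^-1` A).
  apply/seteqP; split=> [x /= vxA|x [t [Kt VtA] <-] /=]; last by rewrite vV.
  have [t Kt tx] := qK x; exists t => //; split=> //.
  by rewrite /= -vV// tx.
apply: compact_closed => //; apply: continuous_compact.
  exact: continuous_subspaceT.
apply: compact_closedI => //.
by move/continuous_closedP: cV; exact.
Qed.

Lemma hausdorff_annulus (R : realType) : hausdorff_space (annulus R).
Proof.
pose j (x : annulus R) : R * (R * R) :=
  (\val x.1, (Re (\val x.2), Im (\val x.2))).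
have cz : continuous (fun x : annulus R => \val x.2 : R[i]^o).
  apply: continuous_comp_total (@continuous_circle_val R).
  exact: continuous_annulus_snd.
have cj : continuous j.
  apply: continuous_pair; first exact: continuous_annulus_fst.
  apply: continuous_pair.
    exact: (continuous_comp_total cz (@continuous_Re R)).
  exact: (continuous_comp_total cz (@continuous_Im R)).
apply: (injective_hausdorff cj); last exact: norm_hausdorff.
move=> [[a a01] [[b b'] ib]] [[c c01] [[e e'] ie]] [/= ac be be'].
by congr pair; apply: val_inj; rewrite /= ?ac ?be ?be'.
Qed.

Definition unit_square (R : realType) : set (R * R) :=
  [set x | 0 <= x.1 <= 1 /\ 0 <= x.2 <= 1].

Lemma compact_unit_square (R : realType) : compact (@unit_square R).
Proof.
have -> : @unit_square R = (`[0, 1] `*` `[0, 1])%classic.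
  by apply/seteqP; split=> x /=; rewrite !in_itv.
by apply: compact_setX; exact: segment_compact.
Qed.

Lemma annulus_pt_surj (R : realType) (x : annulus R) :
  exists2 t, unit_square t & annulus_pt t = x.
Proof.
case: x => [[a a01] z]; have [b b01 zE] := expi_surj (norm_circle z).
have a01' : 0 <= a <= 1 by have := set_mem a01; rewrite /= in_itv.
exists (a, b) => //.
by congr pair; apply: val_inj; rewrite //= clamp_id.
Qed.

Lemma compact_annulus (R : realType) : compact [set: annulus R].
Proof.
have <- : @annulus_pt R @` @unit_square R = [set: annulus R].
  apply/seteqP; split=> // x _; have [t Kt tx] := annulus_pt_surj x.
  by exists t.
apply: continuous_compact; last exact: compact_unit_square.
exact/continuous_subspaceT/continuous_annulus_pt.
Qed.

Lemma has_degree_lift (R : realType) (d : int)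
    (f : continuousType (annulus R) (annulus R)) : has_degree f d ->
  exists2 v : annulus R -> R, continuous v &
    forall x, \val (f x).2 = (\val x.2 : R[i]) ^ d * expi (v x).
Proof.
move=> /has_degree_winding fd.
have cf : continuous (fun x => \val (f (annulus_pt x)).2 : R[i]^o).
  apply: (continuous_comp_total _ (@continuous_circle_val R)).
  apply: (continuous_comp_total _ (@continuous_annulus_snd R)).
  exact: (continuous_comp_total (@continuous_annulus_pt R) (@cts_fun _ _ f)).
have [G cG GE] := circle_lift_square cf (fun x => norm_circle _).
have i0 : 0 <= (0 : R) <= 1 by rewrite lexx ler01.
have i1 : 0 <= (1 : R) <= 1 by rewrite lexx ler01.
have cl y := continuous_section1 (y := y) cG.
have cr x := continuous_section2 (x := x) cG.
have G0 : G (0, 1) - G (0, 0) = d%:~R.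
  rewrite -fd; apply/esym/(@path_lift_winding _ _ (fun t => G (0, t))).
  split=> // t t01; rewrite -GE//=; congr (\val (f _).2).
  by rewrite /core_loop_fun /bary !mxE /= clamp_id.
(* Sliding the loop from height 0 to height [a], the two sides of the cut lift the same path, so
   both ends of G move by the same amount. The parameter [s] rescales the slide to [0, 1]. *)
have Gd a : 0 <= a <= 1 -> G (a, 1) - G (a, 0) = d%:~R.
  move=> a01; have cM : continuous (fun s : R => s * a).
    by move=> s; apply: cvgMl; exact: cvg_id.
  rewrite -G0.
  have := @lift_endpoints R (fun s => G (s * a, 1)) (fun s => G (s * a, 0))
    (continuous_comp_total cM (cl 1)) (continuous_comp_total cM (cl 0)).
  rewrite !mul1r !mul0r => H.
  suff E : G (a, 1) - G (0, 1) = G (a, 0) - G (0, 0) by lra.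
  apply: H => s s01.
  have sa : 0 <= s * a <= 1.
    by case/andP: a01 => ? ?; case/andP: s01 => ? ?; apply/andP; split; nra.
  rewrite -!GE//; congr (\val (f _).2); congr pair; apply: val_inj => /=.
  by rewrite expi0 expi1.
(* The linear term is the lift of [z ^ d]; removing it cancels the jump [d]. *)
pose V (x : R * R) := G x - d%:~R * x.2.
have cV : continuous V.
  move=> x; apply: cvgB; first exact: cG.
  by apply: cvgMr; exact: continuous_snd.
have Vexp x : unit_square x ->
    \val (f (annulus_pt x)).2 = (expi x.2 : R[i]) ^ d * expi (V x).
  by move=> [? ?]; rewrite -expiMz -expiD GE// -mulrzl addrC subrK.
(* V (u, 1) = V (u, 0), so V factors through the annulus. *)
have Veq x y : unit_square x -> unit_square y ->
    annulus_pt x = annulus_pt y -> V x = V y.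
  case: x y => [a b] [a' b'] [/= a01 b01] [/= a01' b01'] xy.
  (* Two angles in [0, 1] with the same image differ by 0 or 1; the difference 1 occurs only at the
     two ends of the cut. *)
  have ab (u v w : R) : 0 <= u <= 1 -> 0 <= v <= 1 -> 0 <= w <= 1 ->
      annulus_pt (u, v) = annulus_pt (u, w) -> v <= w -> V (u, v) = V (u, w).
    move=> u01 v01 w01 /(congr1 (fun x => \val x.2))/= vw vlw.
    have /intrP[k kE] : w - v \is a Num.int.
      by apply: expi_eq1; rewrite expiD expiN vw divff// expi_neq0.
    have k0 : 0 <= k by rewrite -(ler_int R) -kE subr_ge0.
    have k1 : k <= 1.
      rewrite -(ler_int R) -kE.
      by case/andP: v01 => ? ?; case/andP: w01 => ? ?; lra.
    have [k00|k01] : k = 0 \/ k = 1 by clear -k0 k1; lia.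
      congr V; congr pair; move: kE.
      by rewrite k00 => /eqP; rewrite subr_eq0 => /eqP.
    rewrite k01 in kE; have [-> ->] : v = 0 /\ w = 1.
      by case/andP: v01 => ? ?; case/andP: w01 => ? ?; split; lra.
    by rewrite /V /= mulr0 subr0 mulr1 -(Gd u u01); lra.
  have aa : a = a'.
    by move/(congr1 (fun x => \val x.1)): xy => /=; rewrite !clamp_id.
  rewrite -aa in xy *.
  by have [le|/ltW le] := leP b b'; [apply: ab | apply/esym/ab].
(* An arbitrary choice of preimages, with no continuity claimed; the continuity of [V] after [sec]
   comes from [continuous_compact_factor]. *)
pose sec (x : annulus R) := sval (cid2 (annulus_pt_surj x)).
have secK x : unit_square (sec x) by rewrite /sec; case: cid2.
have secE x : annulus_pt (sec x) = x by rewrite /sec; case: cid2.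
have vV t : unit_square t -> V (sec (annulus_pt t)) = V t.
  by move=> Kt; apply: Veq.
exists (fun x => V (sec x)).
  apply: (continuous_compact_factor (@hausdorff_annulus R)
    (@compact_unit_square R) (@continuous_annulus_pt R) cV
    (@annulus_pt_surj R)).
  exact: vV.
by move=> x; rewrite -[in LHS](secE x) Vexp// -[in RHS](secE x) /= secE.
Qed.

(** * The cohomological equation *)

(** The solution is the sum of the c^(k+1) v f^k; the bound on [v] makes the convergence uniform, so
    the limit is continuous. *)
Lemma cohomological_equation (R : realType) (T : topologicalType) (f : T -> T)
    (v : T -> R) (c : R) :
  compact [set: T] -> continuous f -> continuous v -> `|c| <= 1 / 2 ->
  exists2 u : T -> R, continuous u & forall x, u x = c * (v x + u (f x)).
Proof.
move=> cT cf cv c2.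
have [M [Mr MP]] : bounded_set (v @` [set: T]).
  apply/compact_bounded/continuous_compact => //.
  exact: continuous_subspaceT.
(* Boundedness gives a bound only for the reals strictly above [M]; the absolute value also makes
   [B] nonnegative. *)
pose B := `|M| + 1.
have vB x : `|v x| <= B.
  apply: MP; last by exists x.
  by rewrite (le_lt_trans (ler_norm _))// ltrDl.
have B0 : 0 <= B by rewrite addr_ge0.
pose t k x := c ^+ k.+1 * v (iter k f x).
pose S n x := \sum_(k < n) t k x.
have citer k : continuous (iter k f).
  elim: k => [|k IH]; first by move=> x; exact: cvg_id.
  exact: (continuous_comp_total IH cf).
have cS n : continuous (S n).
  elim: n => [|n IH] x; rewrite /S.
    by under eq_fun do rewrite big_ord0; exact: cst_continuous.
  under eq_fun do rewrite big_ord_recr /=.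
  apply: cvgD; first exact: IH.
  by apply: cvgMr; apply: continuous_comp_total (citer n) cv _.
have c0 := normr_ge0 c.
(* The factor 1 - |c|^k avoids dividing by 1 - |c|: the induction step needs 2 |c|^(k+1) <= |c|^k,
   which is where the bound 1/2 on |c| enters. *)
have Sdist n k x : `|S (n + k)%N x - S n x| <= B * `|c| ^+ n * (1 - `|c| ^+ k).
  elim: k => [|k IH]; first by rewrite addn0 !subrr normr0 mulr0.
  have tk : `|t (n + k)%N x| <= B * `|c| ^+ n * (`|c| ^+ k * `|c|).
    have -> : B * `|c| ^+ n * (`|c| ^+ k * `|c|) = `|c| ^+ (n + k).+1 * B.
      by rewrite exprS exprD; ring.
    by rewrite normrM normrX ler_wpM2l ?exprn_ge0.
  rewrite addnS {1}/S big_ord_recr /= -/(S _ _) addrAC.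
  apply: le_trans (ler_normD _ _) _; apply: le_trans (lerD IH tk) _.
  rewrite -mulrDr ler_wpM2l ?mulr_ge0 ?exprn_ge0//.
  have : 0 <= `|c| ^+ k by rewrite exprn_ge0.
  rewrite exprSr; nra.
have Scauchy n m x : (n <= m)%N -> `|S m x - S n x| <= B * `|c| ^+ n.
  move=> nm; rewrite -(subnKC nm); apply: le_trans (Sdist _ _ _) _.
  have h : 0 <= B * `|c| ^+ n by rewrite mulr_ge0 ?exprn_ge0.
  have h' : 0 <= `|c| ^+ (m - n) by rewrite exprn_ge0.
  by rewrite ler_piMr// lerBlDr lerDl.
have cn e : 0 < e -> exists n, B * `|c| ^+ n < e.
  move=> e0.
  have /cvgrPdist_lt : (fun n => B * `|c| ^+ n) @ \oo --> (B * 0 : R).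
    by apply: cvgMr; apply: cvg_expr; rewrite normr_id; lra.
  move=> /(_ _ e0)[n _ /(_ n (leqnn n))].
  rewrite /= mulr0 sub0r normrN => h; exists n.
  exact: le_lt_trans (ler_norm _) h.
have Scvg x : cvgn (S ^~ x).
  have -> : S ^~ x = series (t ^~ x).
    by apply/funext => n; rewrite /series /= big_mkord.
  apply: normed_cvg; apply: (series_le_cvg (v_ := geometric (`|c| * B) `|c|)).
  - by move=> n /=.
  - by move=> n /=; rewrite !mulr_ge0 ?exprn_ge0.
  - move=> n /=.
    have -> : `|c| * B * `|c| ^+ n = `|c| ^+ n.+1 * B by rewrite exprS; ring.
    by rewrite normrM normrX ler_wpM2l ?exprn_ge0.
  by apply: is_cvg_geometric_series; rewrite normr_id; lra.
pose u x := limn (S ^~ x).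
have uS n x : `|u x - S n x| <= B * `|c| ^+ n.
  have cvD : (fun m => `|S m x - S n x|) @ \oo --> `|u x - S n x|.
    by apply: cvg_norm; apply: cvgB; [exact: Scvg | exact: cvg_cst].
  rewrite -(cvg_lim _ cvD)//; apply: limr_le.
    by apply/cvg_ex; eexists; exact: cvD.
  by exists n => // m /= nm; exact: Scauchy.
exists u => [x|x].
  apply/cvgrPdist_lt => e e0.
  have e3 : 0 < e / 3 by rewrite divr_gt0.
  have [n ne] := cn _ e3.
  have /cvgrPdist_lt/(_ _ e3) := cS n x.
  apply: filterS => y Sy.
  have -> : u x - u y = (u x - S n x) + (S n x - S n y) - (u y - S n y) by ring.
  apply: le_lt_trans (ler_normB _ _) _.
  apply: le_lt_trans (lerD (ler_normD _ _) (lexx _)) _.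
  by have := uS n x; have := uS n y; lra.
(* Splitting off the term k = 0 leaves a partial sum along the orbit of [f x]; the functional
   equation is the limit of this identity. *)
have Srec n : S n.+1 x = c * (v x + S n (f x)).
  rewrite /S big_ord_recl /= mulrDr; congr (_ + _); rewrite /t ?expr1//.
  rewrite mulr_sumr; apply: eq_bigr => i _.
  by rewrite -iterSr -lift0 [in LHS]exprS mulrA.
have l1 : (fun n => S n.+1 x) @ \oo --> u x.
  by rewrite (cvg_shiftS (S ^~ x)); exact: Scvg.
have l2 : (fun n => S n.+1 x) @ \oo --> c * (v x + u (f x)).
  under eq_fun do rewrite Srec.
  by apply: cvgMr; apply: cvgD; [exact: cvg_cst | exact: Scvg].
exact: (cvg_unique (@Rhausdorff R) l1 l2).
Qed.

(** * Homotopy invariance of the first homology group *)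

Lemma bary_ge0 (R : realType) n (j : 'I_n.+1) (v : simplex R n) : 0 <= bary j v.
Proof. by have [v0 _] := set_valP v; exact: v0. Qed.

Lemma bary_sum1 (R : realType) (v : simplex R 1) : bary 0 v = 1 - bary 1 v.
Proof.
have [_ v1] := set_valP v; rewrite big_ord_recl big_ord1 in v1.
have i1 : lift ord0 ord0 = 1 :> 'I_2 by exact: val_inj.
by rewrite -v1 i1 addrK.
Qed.

Lemma edgeK (R : realType) (v : simplex R 1) : edge (bary 1 v) = v.
Proof.
have c : clamp (bary 1 v) = bary 1 v.
  by apply: clamp_id; rewrite bary_ge0 -subr_ge0 -bary_sum1 bary_ge0.
apply/val_inj/rowP => j; rewrite mxE c -bary_sum1.
by case: j => -[|[|//]] ij /=; congr (_ _ _); exact: val_inj.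
Qed.

Lemma vertex_subproof (R : realType) : (const_mx 1 : 'rV[R]_1) \in simplex R 0.
Proof. by apply/mem_set; split=> [i|]; rewrite ?big_ord1 !mxE. Qed.

Definition vertex (R : realType) : simplex R 0 :=
  exist (fun w => w \in simplex R 0) (const_mx 1) (vertex_subproof R).

Lemma continuous_prism (R : realType) (X Y : topologicalType)
    (H : continuousType (X * R)%type Y) (n : nat)
    (s : continuousType (simplex R 1) X) (t h : simplex R n -> R) :
  continuous t -> continuous h ->
  continuous (fun b : simplex R n => H (s (edge (t b)), h b)).
Proof.
move=> ct ch; apply: (continuous_comp_total _ (@cts_fun _ _ H)).
apply: continuous_pair => //.
apply: (continuous_comp_total (g := fun x => s (edge x)) ct).
exact: (continuous_comp_total (@continuous_edge R) (@cts_fun _ _ s)).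
Qed.

Lemma continuous_bary12 (R : realType) :
  continuous (fun b : simplex R 2 => bary 1 b + bary 2 b).
Proof.
have c : continuous (fun b : simplex R 2 => (bary 1 b, bary 2 b)).
  by apply: continuous_pair; exact: continuous_bary.
apply: (continuous_comp_total (g := fun x => x.1 + x.2) c) => x.
by apply: cvgD; [exact: continuous_fst|exact: continuous_snd].
Qed.

(* The prism over an edge [v0,v1], with upper edge [w0,w1], is cut into the
   triangles [v0,w0,w1] and [v0,v1,w1]. *)
Definition upper_prism (R : realType) (X Y : topologicalType)
    (H : continuousType (X * R)%type Y) (s : continuousType (simplex R 1) X) :
    continuousType (simplex R 2) Y :=
  cts_of (continuous_prism (H := H) (s := s)
    (@continuous_bary R 2 2) (@continuous_bary12 R)).

Definition lower_prism (R : realType) (X Y : topologicalType)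
    (H : continuousType (X * R)%type Y) (s : continuousType (simplex R 1) X) :
    continuousType (simplex R 2) Y :=
  cts_of (continuous_prism (H := H) (s := s)
    (@continuous_bary12 R) (@continuous_bary R 2 2)).

Lemma continuous_vertex_prism (R : realType) (X Y : topologicalType)
    (H : continuousType (X * R)%type Y) (s : continuousType (simplex R 0) X) :
  continuous (fun b : simplex R 1 => H (s (vertex R), bary 1 b)).
Proof.
apply: (continuous_comp_total _ (@cts_fun _ _ H)); apply: continuous_pair.
  exact: cst_continuous.
exact: continuous_bary.
Qed.

Definition vertex_prism (R : realType) (X Y : topologicalType)
    (H : continuousType (X * R)%type Y) (s : continuousType (simplex R 0) X) :
    continuousType (simplex R 1) Y :=
  cts_of (@continuous_vertex_prism _ _ _ H s).

(** The signs are those of the classical prism operator P, for which the boundary of P is g - f -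
    P(boundary). *)
Definition edge_prism (R : realType) (X Y : topologicalType)
    (H : continuousType (X * R)%type Y) (s : continuousType (simplex R 1) X) :
    chain R 2 Y :=
  gen_chain (upper_prism H s) - gen_chain (lower_prism H s).

Definition prism1 (R : realType) (X Y : topologicalType)
    (H : continuousType (X * R)%type Y) : chain R 1 X -> chain R 2 Y :=
  fglift (edge_prism H).

Definition prism0 (R : realType) (X Y : topologicalType)
    (H : continuousType (X * R)%type Y) : chain R 0 X -> chain R 1 Y :=
  fglift (fun s => gen_chain (vertex_prism H s)).

HB.instance Definition _ (R : realType) (X Y : topologicalType)
    (H : continuousType (X * R)%type Y) :=
  GRing.isZmodMorphism.Build _ _ (prism1 H) (lift_is_additive (edge_prism H)).

HB.instance Definition _ (R : realType) (X Y : topologicalType)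
    (H : continuousType (X * R)%type Y) :=
  GRing.isZmodMorphism.Build _ _ (prism0 H)
    (lift_is_additive (fun s => gen_chain (vertex_prism H s))).

Lemma prism1_gen (R : realType) (X Y : topologicalType)
    (H : continuousType (X * R)%type Y) (s : continuousType (simplex R 1) X) :
  prism1 H (gen_chain s) =
  gen_chain (upper_prism H s) - gen_chain (lower_prism H s).
Proof. by rewrite /prism1 liftU scale1r. Qed.

Lemma prism0_gen (R : realType) (X Y : topologicalType)
    (H : continuousType (X * R)%type Y) (s : continuousType (simplex R 0) X) :
  prism0 H (gen_chain s) = gen_chain (vertex_prism H s).
Proof. by rewrite /prism0 liftU scale1r. Qed.

Lemma bary_face (R : realType) n (i : 'I_n.+2) (k : 'I_n.+2) (v : simplex R n) :
  bary k (face i v) = if unlift i k is Some j then bary j v else 0.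
Proof. by rewrite /bary mxE. Qed.

Lemma bary_faces (R : realType) (v : simplex R 1) :
  [/\ bary 1 (face 0 v) = bary 0 v /\ bary 2 (face 0 v) = bary 1 v,
      bary 1 (face 1 v) = 0 /\ bary 2 (face 1 v) = bary 1 v &
      bary 1 (face 2 v) = bary 1 v /\ bary 2 (face 2 v) = 0].
Proof.
split; split; rewrite bary_face; case: unliftP => [j|] /(congr1 val)//=.
all: case: j => -[|[|//]] ij //= _; congr (bary _ v); exact: val_inj.
Qed.

Lemma gen_chain_ext (R : realType) n (X : topologicalType)
    (s s' : continuousType (simplex R n) X) :
  s =1 s' -> gen_chain s = gen_chain s'.
Proof. by move=> ss'; congr gen_chain; exact/continuousEP. Qed.

Lemma face_vertex (R : realType) (k : 'I_2) :
  face k (vertex R) = edge (if k == 0 then 1 else 0).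
Proof.
apply/val_inj/rowP => j; rewrite /= !mxE clamp_id; last first.
  by case: ifP; rewrite lexx ler01.
case: unliftP => [i|] => [/(congr1 val)|/(congr1 val)]/=; rewrite ?mxE.
all: case: k j => -[|[|//]] ik [[|[|//]]] ij //=; rewrite ?subr0 ?subrr //.
all: by case: i => -[].
Qed.

(** Face 1 of both triangles is the diagonal [v0,w1], which cancels. Face 0 of the upper triangle is
    the top and face 2 of the lower one the bottom; the two remaining faces are the vertical sides,
    over v0 and v1. *)
Lemma boundary_prism_gen (R : realType) (X Y : topologicalType)
    (H : continuousType (X * R)%type Y) (f g : continuousType X Y)
    (s : continuousType (simplex R 1) X) :
  (forall x, H (x, 0) = f x) -> (forall x, H (x, 1) = g x) ->
  boundary (prism1 H (gen_chain s)) =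
  chain_map g (gen_chain s) - chain_map f (gen_chain s)
    - prism0 H (boundary (gen_chain s)).
Proof.
move=> H0 H1; rewrite prism1_gen !chain_map_gen raddfB /=.
rewrite (boundary_gen (upper_prism H s)) (boundary_gen (lower_prism H s)).
rewrite (boundary_gen s) !big_ord_recl !big_ord0 !addr0 expr0 expr1 sqrrN.
rewrite expr1n !scale1r !scaleN1r.
have prism0B a b : prism0 H (a - b) = prism0 H a - prism0 H b by exact: raddfB.
rewrite prism0B !prism0_gen.
have i1 n : lift ord0 ord0 = 1 :> 'I_n.+2 by exact: val_inj.
have i2 : lift ord0 1 = 2 :> 'I_3 by exact: val_inj.
rewrite !i1 i2.
rewrite (@gen_chain_ext _ _ _ (upper_prism H s \o face ord0)
  (g \o s)); last first.
  move=> v; have [[/= -> ->] _ _] := bary_faces v.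
  by rewrite bary_sum1 subrK H1 edgeK.
rewrite (@gen_chain_ext _ _ _ (upper_prism H s \o face 1)
  (lower_prism H s \o face 1)); last first.
  by move=> v; have [_ [/= -> ->] _] := bary_faces v; rewrite add0r.
rewrite (@gen_chain_ext _ _ _ (upper_prism H s \o face 2)
  (vertex_prism H (s \o face 1))); last first.
  by move=> v; have [_ _ [/= -> ->]] := bary_faces v; rewrite addr0 face_vertex.
rewrite (@gen_chain_ext _ _ _ (lower_prism H s \o face ord0)
  (vertex_prism H (s \o face ord0))); last first.
  move=> v; have [[/= -> ->] _ _] := bary_faces v.
  by rewrite bary_sum1 subrK face_vertex.
rewrite (@gen_chain_ext _ _ _ (lower_prism H s \o face 2) (f \o s)); last first.
  by move=> v; have [_ _ [/= -> ->]] := bary_faces v; rewrite addr0 H0 edgeK.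
move: (gen_chain _) (gen_chain _) (gen_chain _) (gen_chain _) (gen_chain _).
move=> F P0 P1 D A.
rewrite !opprD !opprK -!addrA; congr (_ + _).
by rewrite (addrCA (- P0)) (addrCA P1) addKr addrA addrC (addrC P1).
Qed.

(** On a cycle the term through [prism0] vanishes, so the prism bounds the difference of the two
    images. *)
Lemma homotopic_homology_map1 (R : realType) (X Y : topologicalType)
    (H : continuousType (X * R)%type Y) (f g : continuousType X Y) :
  (forall x, H (x, 0) = f x) -> (forall x, H (x, 1) = g x) ->
  @homology_map R 1 _ _ f =1 @homology_map R 1 _ _ g.
Proof.
move=> H0 H1; elim/quotW => z; rewrite -[\pi z]/(homology_class z).
rewrite !homology_map_class; apply/esym/homology_class_eq.
exists (prism1 H (\val z)).
have E : @boundary R 2 Y \o prism1 H =1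
  (@chain_map R 1 _ _ g \- chain_map f) \- (prism0 H \o @boundary R 1 X).
  by apply: chain_ext => s; exact: boundary_prism_gen.
by rewrite [LHS]E /= (eqP (valP z)) raddf0 subr0.
Qed.

Lemma homology_map_id (R : realType) n (X : topologicalType)
    (f : continuousType X X) : f =1 id -> @homology_map R n _ _ f =1 id.
Proof.
move=> f1; elim/quotW => z; rewrite -[\pi z]/(homology_class z).
rewrite homology_map_class.
congr homology_class; apply: val_inj.
apply: (@chain_ext R n X _ (chain_map f) (idfun : {additive _ -> _})) => s.
apply: etrans (chain_map_gen f s) _.
by apply: gen_chain_ext => v /=; rewrite f1.
Qed.

(** Taking any [k] that agrees pointwise with the composite lets one choose how its continuity is
    bundled. *)
Lemma homology_map_comp (R : realType) n (X Y Z : topologicalType)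
    (f : continuousType X Y) (g : continuousType Y Z) (k : continuousType X Z) :
  k =1 g \o f ->
  @homology_map R n _ _ k =1 @homology_map R n _ _ g \o @homology_map R n _ _ f.
Proof.
move=> kE; elim/quotW => z; rewrite -[\pi z]/(homology_class z) /=.
rewrite !homology_map_class; congr homology_class; apply: val_inj.
apply: (@chain_ext R n X _ (chain_map k) (chain_map g \o chain_map f)) => s.
rewrite [LHS]chain_map_gen [RHS]/= !chain_map_gen.
by apply: gen_chain_ext => v /=; rewrite kE.
Qed.

(** * The annulus retracts onto its circle *)

Lemma continuous_annulus_inj (R : realType) :
  continuous (fun z : circle R => (interval_pt 0, z) : annulus R).
Proof.
apply: (@continuous_pair _ (set_type `[0 : R, 1]) (circle R)).
  exact: cst_continuous.
by move=> x; exact: cvg_id.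
Qed.

(** This homotopy goes from the retraction onto {0} x S^1 to the identity; the clamp in
    [interval_pt] keeps it in the annulus at every real time. *)
Lemma continuous_annulus_contraction (R : realType) :
  continuous (fun x : annulus R * R =>
    (interval_pt (x.2 * \val x.1.1), x.1.2) : annulus R).
Proof.
have cx := @continuous_fst (annulus R) R.
have ct : continuous (fun x : annulus R * R => \val x.1.1 : R).
  exact: (continuous_comp_total cx (@continuous_annulus_fst R)).
apply: (@continuous_pair _ (set_type `[0 : R, 1]) (circle R)
  (fun x : annulus R * R => interval_pt (x.2 * \val x.1.1)) (fun x => x.1.2)).
  apply: (continuous_comp_total _ (@continuous_interval_pt R)) => x.
  by apply: cvgM; [exact: continuous_snd|exact: ct].
exact: (continuous_comp_total cx (@continuous_annulus_snd R)).
Qed.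

(** The inverse is induced by the inclusion at height 0: one composite is the identity of the
    circle, the other is homotopic to the identity of the annulus. *)
Lemma annulus_proj_bijective (R : realType) :
  bijective (@homology_map R 1 _ _ (annulus_proj R)).
Proof.
pose i := cts_of (@continuous_annulus_inj R).
have cip := continuous_comp_total
  (@cts_fun _ _ (annulus_proj R)) (@cts_fun _ _ i).
have cid : continuous (@id (annulus R)) by move=> x; exact: cvg_id.
exists (@homology_map R 1 _ _ i) => x.
  rewrite -[LHS](@homology_map_comp _ _ _ _ _ _ _ (cts_of cip))//.
  rewrite (@homotopic_homology_map1 _ _ _
    (cts_of (@continuous_annulus_contraction R)) _ (cts_of cid)).
  - exact: homology_map_id.
  - by move=> -[t z] /=; rewrite mul0r.
  - move=> [[t t01] z] /=; congr pair; apply: val_inj => /=.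
    by rewrite mul1r clamp_id//; have := set_mem t01; rewrite /= in_itv.
have ci : continuous (@id (circle R)) by move=> y; exact: cvg_id.
rewrite -[LHS](@homology_map_comp _ _ _ _ _ _ _ (cts_of ci))//.
exact: homology_map_id.
Qed.

(** * Rotation by a real function, and the semiconjugacy *)

Lemma rotate_mem (R : realType) (z : circle R) (t : R) :
  (\val z : R[i]) * expi t \in circle R.
Proof.
by apply/mem_set; rewrite /circle /= normrM norm_circle norm_expi mulr1.
Qed.

Definition rotate (R : realType) (z : circle R) (t : R) : circle R :=
  exist (fun w => w \in circle R) ((\val z : R[i]) * expi t) (rotate_mem z t).

Lemma continuous_rotate (R : realType) (T : topologicalType)
    (z : T -> circle R) (t : T -> R) :
  continuous z -> continuous t -> continuous (fun x => rotate (z x) (t x)).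
Proof.
move=> cz ct; apply: continuous_circle => x; apply: (@cvgM R[i]^o).
  exact: (continuous_comp_total cz (@continuous_circle_val R)).
exact: (continuous_comp_total ct (@continuous_expi R)).
Qed.

Theorem corollary5 (R : realType) (d : int)
  (f : continuousType (annulus R) (annulus R)) :
  1 < `|d| -> has_degree f d -> semiconjugate f (power_map d).
Proof.
move=> d1 /has_degree_lift[v cv fv].
(* An integer of absolute value above 1 has absolute value at least 2, so c = 1/d meets the bound of
   [cohomological_equation]. *)
have d2 : 2 <= `|d%:~R : R| by rewrite -intr_norm (ler_int R 2).
have d0 : (d%:~R : R) != 0 by rewrite -normr_gt0; lra.
have c2 : `|(d%:~R)^-1 : R| <= 1 / 2.
  by rewrite normfV div1r lef_pV2 ?posrE//; lra.
have [u cu uE] := cohomological_equation (@compact_annulus R)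
  (@cts_fun _ _ f) cv c2.
have cz := @continuous_annulus_snd R.
pose h := cts_of (continuous_rotate cz cu).
exists h; split=> [x|].
  (* Both sides now have the factor [z ^ d]; it remains to compare the exponents [v + u f] and
     [d u]. *)
  apply: val_inj => /=; rewrite fv -mulrA -expiD expfzMl -expiMz.
  congr (_ * expi _).
  by rewrite -mulrzl [u x]uE mulVKf.
have cx := @continuous_fst (annulus R) R.
have cH : continuous (fun x : annulus R * R => rotate x.1.2 (x.2 * u x.1)).
  apply: continuous_rotate.
    exact: (continuous_comp_total cx cz).
  move=> x; apply: cvgM; first exact: continuous_snd.
  exact: (continuous_comp_total cx cu).
have hp := @homotopic_homology_map1 R _ _ (cts_of cH) (annulus_proj R) h.
apply: (eq_bij (annulus_proj_bijective R)); apply: hp => x.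
  by apply: val_inj; rewrite /= mul0r expi0 mulr1.
by apply: val_inj; rewrite /= mul1r.
Qed.
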